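(* Let $\mathbb F\in\{\mathbb R,\mathbb C\}$ and let $P(\lambda)=\lambda(J_1+R_1)+(J_2+R_2)\in\mathbb F^{n,n}[\lambda]$, where $J_i^*=-J_i$ and $R_i^*=R_i\ge 0$ for $i=1,2$. (i) If $P(\lambda)$ is singular, then for each $i\in\{1,2\}$ the matrices $J_i,R_1,R_2$ have a common kernel, i.e. $\ker J_i\cap\ker R_1\cap\ker R_2\ne\{0\}$. (ii) If the pencil $\lambda R_1+R_2$ is regular, then $P(\lambda)$ is regular and has no eigenvalues on the real positive axis. (iii) If the pencil $\lambda J_1+J_2$ is regular, then $P(\lambda)$ is regular and every real positive eigenvalue of $P(\lambda)$ is also an eigenvalue of the pencil $\lambda J_1+J_2$. (iv) If the pencil $\lambda R_1+J_2$ is regular, then $P(\lambda)$ is regular, and if $x\in\mathbb F^n\setminus\{0\}$ is an eigenvector associated with a real positive eigenvalue $\alpha$ of $P(\lambda)$, then $(\alpha J_1+J_2)x=0$. (v) If the pencil $\lambda R_2+J_1$ is regular, then $P(\lambda)$ is regular, and if $x\in\mathbb F^n\setminus\{0\}$ is an eigenvector associated with a real positive eigenvalue $\alpha$ of $P(\lambda)$, then $(\alpha J_1+J_2)x=0$.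
   Context: $M^*$ denotes the conjugate transpose, $M\ge 0$ means Hermitian positive semidefinite. A square pencil $\lambda A+B$ is regular if $\det(\lambda_0A+B)\ne0$ for some $\lambda_0\in\mathbb C$, and singular otherwise. For a regular pencil, $\lambda_0\in\mathbb C$ is an eigenvalue with eigenvector $x\neq 0$ if $(\lambda_0A+B)x=0$. *)

(* Defs.v *)
From HB Require Import structures.
From mathcomp Require Import all_boot all_order all_algebra spectral.
From mathcomp Require Import all_classical reals.
From mathcomp Require Export complex.

Set Implicit Arguments.
Unset Strict Implicit.
Unset Printing Implicit Defensive.

Import Order.TTheory GRing.Theory Num.Theory.
Local Open Scope ring_scope.
Local Open Scope sesquilinear_scope.
Local Open Scope complex_scope.
Local Open Scope classical_set_scope.

(* The complex numbers are R[i] for R : realType. A field F in {R, C} is a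
   subset of R[i], either the real axis or everything, and F^{m,n} is the set
   of complex matrices M such that M \is a mxOver F. *)
Definition real_or_complex (R : realType) (F : {pred R[i]}) : Prop :=
  F =i Num.real \/ F =i predT.

(* In the order of R[i], 0 <= z means that z is real and nonnegative. *)
Definition psdmx (R : realType) (n : nat) (M : 'M[R[i]]_n) : Prop :=
  M ^t* = M /\ forall x : 'cV[R[i]]_n, 0 <= (x ^t* *m M *m x) 0 0.

(* The kernel in F^n, for the action on column vectors (mxalgebra's kermx is
   the kernel of the action on row vectors). *)
Definition kerF (R : realType) (F : {pred R[i]}) (m n : nat)
    (M : 'M[R[i]]_(m, n)) : set 'cV[R[i]]_n :=
  [set x | x \is a mxOver F /\ M *m x = 0].

(* The pencil lambda A + B is given by its coefficients A and B; pencil A B l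
   is its value at lambda = l. *)
Definition pencil (R : realType) (n : nat) (A B : 'M[R[i]]_n) (l : R[i]) :
  'M[R[i]]_n := l *: A + B.

Definition regular_pencil (R : realType) (n : nat) (A B : 'M[R[i]]_n) : Prop :=
  exists l : R[i], \det (pencil A B l) != 0.

Definition singular_pencil (R : realType) (n : nat) (A B : 'M[R[i]]_n) : Prop :=
  ~ regular_pencil A B.

Definition pencil_eigenvector (R : realType) (n : nat) (A B : 'M[R[i]]_n)
    (l : R[i]) (x : 'cV[R[i]]_n) : Prop :=
  x != 0 /\ pencil A B l *m x = 0.

(* Only meaningful for regular pencils. *)
Definition pencil_eigenvalue (R : realType) (n : nat) (A B : 'M[R[i]]_n)
    (l : R[i]) : Prop :=
  exists x : 'cV[R[i]]_n, pencil_eigenvector A B l x.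

(* Main.v *)
Require Import Defs.
From HB Require Import structures.
From mathcomp Require Import all_boot all_order all_algebra spectral.
From mathcomp Require Import all_classical reals.
From mathcomp Require Import ring.

Set Implicit Arguments.
Unset Strict Implicit.
Unset Printing Implicit Defensive.

Import Order.TTheory GRing.Theory Num.Theory.
Local Open Scope ring_scope.
Local Open Scope sesquilinear_scope.
Local Open Scope complex_scope.
Local Open Scope classical_set_scope.

(** Write [P] for the pencil with coefficients [J1 + R1], [J2 + R2].  At a real
    [alpha > 0], the quantity [x^* P(alpha) x] has real part
    [alpha (x^* R1 x) + x^* R2 x], since [J1], [J2] are skew-Hermitian; both terms
    are nonnegative.  Hence both vanish if [x] is a null vector of [P(alpha)], and
    by semidefiniteness [x] lies in [ker R1] and [ker R2]; what remains of
    [P(alpha) x = 0] is [(alpha J1 + J2) x = 0] ([pencil_null_pos]).  All the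
    claims on eigenvalues are read off from these three equations.

    If [P] is singular, such an [x] exists for every [alpha > 0].  Suppose that
    [J1], [R1], [R2] had no common kernel.  Then the matrix obtained by stacking
    them has a left inverse [L], and [R1 x = R2 x = 0],
    [(alpha J1 + J2) x = 0] show that [x] is an eigenvector, with eigenvalue
    [alpha], of the square matrix [- L [J2; 0; 0]], which does not depend on
    [alpha].  This is absurd, as a matrix has finitely many eigenvalues
    ([common_ker_of_pos]).  The substitution [alpha -> 1 / alpha] exchanges the
    roles of [J1] and [J2].  Over the real field, real and imaginary parts of a
    complex null vector provide a real one ([ker_over]).

    Regularity of [P] in (ii), (iv) and (v) follows by contraposition, since a
    common kernel makes the corresponding subpencil singular.  In (iii) it
    follows because a regular pencil is invertible at some [alpha > 0], its
    determinant having finitely many roots. *)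

(** * Null vectors of semidefinite and real matrices *)

Section Forms.
Variable C : numClosedFieldType.

Lemma trmxCM m n p (A : 'M[C]_(m, n)) (B : 'M[C]_(n, p)) :
  (A *m B) ^t* = B ^t* *m A ^t*.
Proof. by rewrite trmx_mul map_mxM. Qed.

Lemma sqnorm_ge0 n (y : 'cV[C]_n) : 0 <= (y ^t* *m y) 0 0.
Proof.
by rewrite mxE sumr_ge0 // => i _; rewrite !mxE mulrC mul_conjC_ge0.
Qed.

Lemma sqnorm_eq0 n (y : 'cV[C]_n) : (y ^t* *m y) 0 0 = 0 -> y = 0.
Proof.
rewrite mxE => y0; apply/colP => i; rewrite [RHS]mxE; apply/eqP.
have ge0 (k : 'I_n) : true -> 0 <= y ^t* 0 k * y k 0.
  by rewrite !mxE mulrC mul_conjC_ge0.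
have /(_ i) := @psumr_eq0P _ _ _ _ ge0 y0.
by rewrite !mxE mulrC => /(_ isT)/eqP; rewrite mul_conjC_eq0.
Qed.

(** The minimum [0] of the quadratic form is attained at [x], so its derivative
    vanishes there in the direction [M x]. *)
Lemma psd_form_eq0 n (M : 'M[C]_n) (x : 'cV[C]_n) :
    M ^t* = M -> (forall z : 'cV[C]_n, 0 <= (z ^t* *m M *m z) 0 0) ->
  (x ^t* *m M *m x) 0 0 = 0 -> M *m x = 0.
Proof.
move=> MH Mge0 x0; set y := M *m x; apply: sqnorm_eq0.
set a := (y ^t* *m y) 0 0; have a_ge0 : 0 <= a by exact: sqnorm_ge0.
set c := (y ^t* *m M *m y) 0 0; have c_ge0 : 0 <= c by exact: Mge0.
have yE : y ^t* = x ^t* *m M by rewrite trmxCM MH.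
(* The form at [x - t y] is [- 2 t a + t^2 c], which is negative for a [t > 0]
   with [t c < 2 a]; the choice of [t] below gives [t c <= a]. *)
pose t := a / (1 + c).
have c1_gt0 : 0 < 1 + c by rewrite ltr_pwDl.
have t_ge0 : 0 <= t by rewrite divr_ge0 // ltW.
have := Mge0 (x - t *: y).
have -> : (x - t *: y) ^t* = x ^t* - t *: y ^t*.
  by apply/matrixP => i j; rewrite !mxE rmorphB rmorphM /= (geC0_conj t_ge0).
rewrite !mulmxBl !mulmxBr -!scalemxAl -!scalemxAr -!mulmxA -/y.
rewrite [x ^t* *m (M *m y)]mulmxA -yE.
have -> : x ^t* *m y = 0.
  by apply/matrixP => i j; rewrite !ord1 [RHS]mxE -x0 /y mulmxA.
have subE (U V : 'M[C]_1) : (U - V) 0 0 = U 0 0 - V 0 0 by rewrite !mxE.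
have scaleE (U : 'M[C]_1) : (t *: U) 0 0 = t * U 0 0 by rewrite mxE.
rewrite sub0r !(subE, scaleE) -/a mulmxA -/c mxE scaleE -/a => h.
have {}h : 2 * (t * a) <= t * (t * c).
  by rewrite -subr_ge0; move: h; congr (0 <= _); ring.
apply/eqP/negPn/negP => a0; have a_gt0 : 0 < a by rewrite lt0r a0.
have t_gt0 : 0 < t by rewrite divr_gt0.
have {}h : 2 * a <= t * c by rewrite -(ler_pM2l t_gt0) mulrCA.
suff tc : t * c <= a.
  by have := le_trans h tc; rewrite mulr_natl mulr2n gerDl (lt_geF a_gt0).
by rewrite /t -mulrA ler_piMr // mulrC ler_pdivrMr // mul1r lerDr.
Qed.

(** The kernel of a real matrix is stable under conjugation, hence contains
    [x + conj x]; if this vanishes, then [x] is purely imaginary and ['i x] is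
    real. *)
Lemma ker_real m n (K : 'M[C]_(m, n)) (x : 'cV[C]_n) :
    K \is a mxOver Num.real -> x != 0 -> K *m x = 0 ->
  exists y : 'cV[C]_n, [/\ y != 0, y \is a mxOver Num.real & K *m y = 0].
Proof.
move=> Kreal x0 Kx; pose xc := map_mx Num.conj x.
have Kxc : K *m xc = 0 by rewrite -[K]realmxC // -map_mxM Kx map_mx0.
have [s0|s0] := eqVneq (x + xc) 0; last first.
  exists (x + xc); split=> //; last by rewrite mulmxDr Kx Kxc addr0.
  by apply/mxOverP => i j; rewrite !mxE CrealE rmorphD /= conjCK addrC.
have xcE : xc = - x by apply/eqP; rewrite -addr_eq0 addrC s0.
exists ('i *: x); split; last by rewrite -scalemxAr Kx scaler0.
  by rewrite scaler_eq0 negb_or neq0Ci.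
apply/mxOverP => i j; rewrite mxE CrealE rmorphM /= conjCi.
have := congr1 (fun A : 'cV_n => A i j) xcE; rewrite !mxE => ->.
by rewrite mulrNN.
Qed.

(** * Determinants of pencils *)

Lemma poly_nonroot_pos (q : {poly C}) :
  q != 0 -> exists k : nat, q.[k.+1%:R] != 0.
Proof.
move=> q0; apply: contrapT => noroot.
have allr k : root q k.+1%:R.
  by apply/rootP; apply/eqP; apply/negPn/negP => h; apply: noroot; exists k.
pose s := [seq (k.+1%:R : C) | k <- iota 0 (size q)].
have /(max_poly_roots q0) : all (root q) s.
  by apply/allP => _ /mapP[k _ ->].
rewrite size_map size_iota ltnn => H; have // : false; apply: H.
by rewrite map_inj_uniq ?iota_uniq // => i j /eqP; rewrite eqr_nat eqSS => /eqP.
Qed.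

Lemma det_pencil_pos n (A B : 'M[C]_n) (l : C) :
  \det (l *: A + B) != 0 -> exists k : nat, \det (k.+1%:R *: A + B) != 0.
Proof.
pose q := \det ('X *: map_mx polyC A + map_mx polyC B).
have qE z : q.[z] = \det (z *: A + B).
  rewrite -/(horner_eval z q) -det_map_mx; congr (\det _).
  by apply/matrixP => i j; rewrite !mxE /= /horner_eval !hornerE.
rewrite -qE => ql; have q0 : q != 0.
  by apply: contraNneq ql => ->; rewrite horner0.
by have [k] := poly_nonroot_pos q0; rewrite qE; exists k.
Qed.

Lemma det_eq0_cV n (A : 'M[C]_n) :
  \det A = 0 <-> exists2 x : 'cV[C]_n, x != 0 & A *m x = 0.
Proof.
rewrite -det_tr; split=> [/eqP/det0P[v v0 vA]|[x x0 Ax]].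
  by exists v^T; rewrite ?trmx_eq0 // -[A]trmxK -trmx_mul vA trmx0.
by apply/eqP/det0P; exists x^T; rewrite ?trmx_eq0 // -trmx_mul Ax trmx0.
Qed.

(** A left inverse of [K] turns the rectangular pencil [alpha K + N] into a monic
    square one, which is singular at finitely many [alpha] only. *)
Lemma ker_lead_of_pos m n (K N : 'M[C]_(m, n)) :
    (forall k : nat, exists2 x : 'cV[C]_n,
       x != 0 & (k.+1%:R *: K + N) *m x = 0) ->
  exists2 x : 'cV[C]_n, x != 0 & K *m x = 0.
Proof.
move=> H; have [Kfree|] := boolP (row_free K^T); last first.
  rewrite -kermx_eq0 => /rowV0Pn[v /sub_kermxP vK v0].
  by exists v^T; rewrite ?trmx_eq0 // -[K]trmxK -trmx_mul vK trmx0.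
have [L KL] := row_freeP Kfree.
have LK : L^T *m K = 1%:M by rewrite -[K]trmxK -trmx_mul KL trmx1.
pose B := L^T *m N.
(* The determinant of [z 1 + B] is the characteristic polynomial of [- B]. *)
have [l] : exists k : nat, \det (k.+1%:R *: 1%:M + B) != 0.
  have [k kB] := poly_nonroot_pos (monic_neq0 (char_poly_monic (- B))).
  apply: (@det_pencil_pos _ _ _ k.+1%:R); move: kB.
  rewrite -/(horner_eval _ _) -det_map_mx; congr (\det _ != 0).
  apply/matrixP => i j; rewrite !mxE /= /horner_eval !hornerE ?hornerMn ?hornerX.
  rewrite opprK; case: (i == j);
    by rewrite ?mulr1n ?mulr0n ?hornerX ?horner0 ?mulr1 ?mulr0.
have [x x0 Hx] := H l; case/eqP; apply/det_eq0_cV; exists x => //.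
by rewrite -LK scalemxAr -mulmxDr -mulmxA Hx mulmx0.
Qed.

Lemma common_ker_of_pos m n (J1 J2 R1 R2 : 'M[C]_(m, n)) :
    (forall k : nat, exists2 x : 'cV[C]_n, x != 0 &
       [/\ R1 *m x = 0, R2 *m x = 0 & (k.+1%:R *: J1 + J2) *m x = 0]) ->
  exists2 x : 'cV[C]_n, x != 0 & col_mx (col_mx J1 R1) R2 *m x = 0.
Proof.
move=> H; apply: (@ker_lead_of_pos _ _ _ (col_mx (col_mx J2 0) 0)) => k.
have [x x0 [R1x R2x Jx]] := H k; exists x => //.
rewrite !scale_col_mx !add_col_mx !mul_col_mx Jx !addr0 -!scalemxAl R1x R2x.
by rewrite !scaler0 !col_mx0.
Qed.

End Forms.

(** * Matrices over the real or complex field *)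

Section Field.
Variables (R : realType) (F : {pred R[i]}).
Hypothesis hF : real_or_complex F.

Lemma over_cases :
  (forall m n (A : 'M[R[i]]_(m, n)),
     (A \is a mxOver F) = (A \is a mxOver Num.real))
  \/ (forall m n (A : 'M[R[i]]_(m, n)), A \is a mxOver F).
Proof.
case: hF => FE; [left | right] => m n A; last by apply/mxOverP => i j; rewrite FE.
by apply/mxOverP/mxOverP => FA i j; move: (FA i j); rewrite FE.
Qed.

Lemma ker_over m n (K : 'M[R[i]]_(m, n)) (x : 'cV[R[i]]_n) :
    K \is a mxOver F -> x != 0 -> K *m x = 0 ->
  exists2 y : 'cV[R[i]]_n, y != 0 & y \is a mxOver F /\ K *m y = 0.
Proof.
case: over_cases => FE; last by move=> _ x0 Kx; exists x.
rewrite FE => Kreal x0 /(ker_real Kreal x0)[y [y0 yreal Ky]].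
by exists y; rewrite ?FE.
Qed.

(** Over the reals, conjugate transposition is transposition, and [J], [S] are
    the skew-symmetric and symmetric parts of the real matrix [J + S]. *)
Lemma herm_parts_over n (J S : 'M[R[i]]_n) :
    J ^t* = - J -> S ^t* = S -> J + S \is a mxOver F ->
  J \is a mxOver F /\ S \is a mxOver F.
Proof.
move=> JH SH; case: over_cases => FE; last by rewrite !FE.
rewrite !FE => Mreal; set M := J + S in Mreal.
have MtE : M^T = S - J.
  have /(congr1 trmx) := realmxC Mreal; rewrite map_trmx => <-.
  by rewrite /M linearD /= map_mxD JH SH addrC.
have Mtreal : M^T \is a mxOver Num.real.
  by apply/mxOverP => i j; rewrite mxE (mxOverP Mreal).
have half_real : (2^-1 : R[i]) \is Num.real by rewrite realV realn.
have SE : S = 2^-1 *: (M + M^T).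
  by rewrite MtE /M [J + S]addrC addrACA subrr addr0 -mulr2n -[S *+ 2]scaler_nat
    scalerA mulVf ?scale1r // pnatr_eq0.
have Sreal : S \is a mxOver Num.real by rewrite SE mxOverZ // realmxD.
split=> //; have -> : J = M + - S by rewrite /M addrK.
apply: realmxD => //; apply/mxOverP => i j.
by rewrite mxE rpredN (mxOverP Sreal).
Qed.

End Field.

(** * Semidissipative pencils *)

Section Pencils.
Variables (R : realType) (n : nat).
Implicit Types A B J S : 'M[R[i]]_n.

Lemma singular_pencilP A B :
  singular_pencil A B <->
  forall l, exists2 x : 'cV[R[i]]_n, x != 0 & pencil A B l *m x = 0.
Proof.
split=> [sing l|H [l]].
  apply/det_eq0_cV; apply/eqP/negPn/negP => d0.
  by apply: sing; exists l.
by have /det_eq0_cV-> := H l; rewrite eqxx.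
Qed.

Lemma regular_pencil_null A B (x : 'cV[R[i]]_n) :
  regular_pencil A B -> A *m x = 0 -> B *m x = 0 -> x = 0.
Proof.
move=> reg Ax Bx; apply/eqP/negPn/negP => x0.
have /singular_pencilP : forall l,
    exists2 y : 'cV[R[i]]_n, y != 0 & pencil A B l *m y = 0.
  by move=> l; exists x; rewrite // mulmxDl -scalemxAl Ax Bx scaler0 addr0.
by apply.
Qed.

Variables J1 J2 R1 R2 : 'M[R[i]]_n.
Hypotheses (hJ1 : J1 ^t* = - J1) (hJ2 : J2 ^t* = - J2).
Hypotheses (hR1 : psdmx R1) (hR2 : psdmx R2).

(** The skew-Hermitian part contributes a purely imaginary number to
    [x^* P(alpha) x], so the two nonnegative Hermitian contributions must vanish
    separately. *)
Lemma pencil_null_pos (a : R[i]) (x : 'cV[R[i]]_n) :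
    0 < a -> pencil (J1 + R1) (J2 + R2) a *m x = 0 ->
  [/\ R1 *m x = 0, R2 *m x = 0 & (a *: J1 + J2) *m x = 0].
Proof.
move=> a_gt0; rewrite /pencil => Px.
have [R1H R1ge0] := hR1; have [R2H R2ge0] := hR2.
pose J := a *: J1 + J2; pose S := a *: R1 + R2.
have PE : a *: (J1 + R1) + (J2 + R2) = J + S.
  by rewrite scalerDr addrACA.
have aZ (M : 'M[R[i]]_n) : (a *: M) ^t* = a *: M ^t*.
  apply/matrixP => i j; rewrite !mxE rmorphM /=.
  by rewrite (geC0_conj (ltW a_gt0)).
have JH : J ^t* = - J.
  by rewrite /J linearD /= map_mxD aZ hJ1 hJ2 scalerN opprD.
have SH : S ^t* = S by rewrite /S linearD /= map_mxD aZ R1H R2H.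
rewrite PE in Px.
have xPx : x ^t* *m J *m x + x ^t* *m S *m x = 0.
  by rewrite -mulmxDl -mulmxDr -mulmxA Px mulmx0.
have xPxH : - (x ^t* *m J *m x) + x ^t* *m S *m x = 0.
  have := congr1 (fun M : 'M_1 => M ^t*) xPx.
  rewrite linearD /= map_mxD !trmxCM JH SH trmxCK !mulmxA mulmxN mulNmx.
  by rewrite trmx0 map_mx0.
have xSx : x ^t* *m S *m x = 0.
  have := congr1 (fun M : 'M_1 => M 0 0) (congr2 +%R xPx xPxH).
  rewrite addrACA subrr add0r addr0 -mulr2n => e; apply/matrixP => i j.
  rewrite !ord1 [RHS]mxE; apply/eqP; move/eqP: e.
  by rewrite mulmxnE [X in _ == X]mxE mulrn_eq0.
have sum0 : a * (x ^t* *m R1 *m x) 0 0 + (x ^t* *m R2 *m x) 0 0 = 0.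
  have := congr1 (fun M : 'M_1 => M 0 0) xSx.
  rewrite /S mulmxDr mulmxDl -scalemxAr -scalemxAl.
  have addE (U V : 'M[R[i]]_1) : (U + V) 0 0 = U 0 0 + V 0 0 by rewrite mxE.
  have scaleE (U : 'M[R[i]]_1) : (a *: U) 0 0 = a * U 0 0 by rewrite mxE.
  by rewrite addE scaleE [RHS]mxE.
have := sum0; move/eqP; rewrite paddr_eq0 ?mulr_ge0 ?(ltW a_gt0) //.
rewrite mulf_eq0 gt_eqF //= => /andP[/eqP r1 /eqP r2].
have R1x := psd_form_eq0 R1H R1ge0 r1.
have R2x := psd_form_eq0 R2H R2ge0 r2.
split=> //; move: Px; rewrite mulmxDl.
by rewrite [S *m x]mulmxDl -scalemxAl R1x R2x scaler0 !addr0.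
Qed.

Hypothesis sing : singular_pencil (J1 + R1) (J2 + R2).

Lemma singular_null_pos (a : R[i]) : 0 < a ->
  exists2 x : 'cV[R[i]]_n, x != 0 &
    [/\ R1 *m x = 0, R2 *m x = 0 & (a *: J1 + J2) *m x = 0].
Proof.
move=> a_gt0; have [x x0 Px] := (singular_pencilP _ _).1 sing a.
by exists x; last exact: pencil_null_pos.
Qed.

Lemma singular_common_ker1 : exists2 x : 'cV[R[i]]_n, x != 0 &
  col_mx (col_mx J1 R1) R2 *m x = 0.
Proof.
by apply: (@common_ker_of_pos _ _ _ _ J2) => k; exact: singular_null_pos.
Qed.

Lemma singular_common_ker2 : exists2 x : 'cV[R[i]]_n, x != 0 &
  col_mx (col_mx J2 R1) R2 *m x = 0.
Proof.
apply: (@common_ker_of_pos _ _ _ _ J1) => k.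
(* The reversed pencil [alpha J2 + J1] has the null vectors of [J1, J2] at
   [1 / alpha]. *)
have [|x x0 [R1x R2x Jx]] := @singular_null_pos k.+1%:R^-1.
  by rewrite invr_gt0 ltr0n.
exists x => //; split=> //.
suff -> : k.+1%:R *: J2 + J1 = k.+1%:R *: (k.+1%:R^-1 *: J1 + J2).
  by rewrite -scalemxAl Jx scaler0.
by rewrite scalerDr scalerA mulfV ?scale1r ?pnatr_eq0 // addrC.
Qed.

End Pencils.

Lemma col_mx3_eq0 (R : nzRingType) n (A B C : 'M[R]_n) (x : 'cV[R]_n) :
  col_mx (col_mx A B) C *m x = 0 ->
  [/\ A *m x = 0, B *m x = 0 & C *m x = 0].
Proof.
rewrite !mul_col_mx => /eqP; rewrite !col_mx_eq0 -andbA.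
by case/and3P => /eqP ? /eqP ? /eqP ?.
Qed.

Lemma kerF_common (R : realType) (F : {pred R[i]}) n (A B C : 'M[R[i]]_n) :
    real_or_complex F ->
    A \is a mxOver F -> B \is a mxOver F -> C \is a mxOver F ->
    (exists2 x : 'cV[R[i]]_n, x != 0 & col_mx (col_mx A B) C *m x = 0) ->
  kerF F A `&` kerF F B `&` kerF F C <> [set 0].
Proof.
move=> hF FA FB FC [x x0 Kx].
have [|y y0 [Fy /col_mx3_eq0[Ay By Cy]]] := ker_over hF _ x0 Kx.
  apply/mxOverP => i j; rewrite !mxE.
  case: splitP => i' _; last exact: (mxOverP FC).
  rewrite mxE; case: splitP => i'' _; first exact: (mxOverP FA).
  exact: (mxOverP FB).
move=> e; move: y0.
have : (kerF F A `&` kerF F B `&` kerF F C) y by [].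
by rewrite e /= => ->; rewrite eqxx.
Qed.

Theorem corollary4p7 (R : realType) (F : {pred R[i]})
    (hF : real_or_complex F) (n : nat) (J1 J2 R1 R2 : 'M[R[i]]_n)
    (hP1 : J1 + R1 \is a mxOver F) (hP2 : J2 + R2 \is a mxOver F)
    (hJ1 : J1 ^t* = - J1) (hJ2 : J2 ^t* = - J2)
    (hR1 : psdmx R1) (hR2 : psdmx R2) :
  (singular_pencil (J1 + R1) (J2 + R2) ->
     kerF F J1 `&` kerF F R1 `&` kerF F R2 <> [set 0] /\
     kerF F J2 `&` kerF F R1 `&` kerF F R2 <> [set 0]) /\
  (regular_pencil R1 R2 ->
     regular_pencil (J1 + R1) (J2 + R2) /\
     forall alpha : R, 0 < alpha ->
       ~ pencil_eigenvalue (J1 + R1) (J2 + R2) alpha%:C) /\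
  (regular_pencil J1 J2 ->
     regular_pencil (J1 + R1) (J2 + R2) /\
     forall alpha : R, 0 < alpha ->
       pencil_eigenvalue (J1 + R1) (J2 + R2) alpha%:C ->
       pencil_eigenvalue J1 J2 alpha%:C) /\
  (regular_pencil R1 J2 ->
     regular_pencil (J1 + R1) (J2 + R2) /\
     forall (alpha : R) (x : 'cV[R[i]]_n), 0 < alpha ->
       x \is a mxOver F ->
       pencil_eigenvector (J1 + R1) (J2 + R2) alpha%:C x ->
       (alpha%:C *: J1 + J2) *m x = 0) /\
  (regular_pencil R2 J1 ->
     regular_pencil (J1 + R1) (J2 + R2) /\
     forall (alpha : R) (x : 'cV[R[i]]_n), 0 < alpha ->
       x \is a mxOver F ->
       pencil_eigenvector (J1 + R1) (J2 + R2) alpha%:C x ->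
       (alpha%:C *: J1 + J2) *m x = 0).
Proof.
have a0 (a : R) : 0 < a -> 0 < a%:C by rewrite -[0 < a]ltcR.
have null a x ha :=
  @pencil_null_pos R n J1 J2 R1 R2 hJ1 hJ2 hR1 hR2 a%:C x (a0 a ha).
have ker1 := @singular_common_ker1 R n J1 J2 R1 R2 hJ1 hJ2 hR1 hR2.
have ker2 := @singular_common_ker2 R n J1 J2 R1 R2 hJ1 hJ2 hR1 hR2.
have [FJ1 FR1] := herm_parts_over hF hJ1 hR1.1 hP1.
have [FJ2 FR2] := herm_parts_over hF hJ2 hR2.1 hP2.
split; [|split; [|split; [|split]]].
- by move=> sing; split; apply: kerF_common => //; [exact: ker1 | exact: ker2].
- move=> reg; split.
    apply: contrapT => /ker1[x x0 /col_mx3_eq0[_ R1x R2x]].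
    by move: x0; rewrite (regular_pencil_null reg R1x R2x) eqxx.
  move=> a a_gt0 [x [x0 /(null _ _ a_gt0)[R1x R2x _]]].
  by move: x0; rewrite (regular_pencil_null reg R1x R2x) eqxx.
- move=> [l /det_pencil_pos[k detk]]; split.
    apply: contrapT => sing.
    have [|x x0 [_ _ Jx]] :=
      singular_null_pos hJ1 hJ2 hR1 hR2 sing (a := k.+1%:R).
      by rewrite ltr0n.
    by case/eqP: detk; apply/det_eq0_cV; exists x.
  by move=> a a_gt0 [x [x0 /(null _ _ a_gt0)[_ _ Jx]]]; exists x.
- move=> reg; split; last by move=> a x a_gt0 _ [_ /(null _ _ a_gt0)[]].
  apply: contrapT => /ker2[x x0 /col_mx3_eq0[J2x R1x _]].
  by move: x0; rewrite (regular_pencil_null reg R1x J2x) eqxx.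
- move=> reg; split; last by move=> a x a_gt0 _ [_ /(null _ _ a_gt0)[]].
  apply: contrapT => /ker1[x x0 /col_mx3_eq0[J1x _ R2x]].
  by move: x0; rewrite (regular_pencil_null reg R2x J1x) eqxx.
Qed.
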